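(* Let $\mathbb{F}$ be an infinite field of arbitrary characteristic $p\ge0$, let $\mathcal{Q}$ be a quiver, $\boldsymbol{n}$ a dimension vector, and $\boldsymbol{i}:\mathcal{Q}_0\to\mathcal{Q}_0$ an involution with $\boldsymbol{i}(v)\ne v$ and $\boldsymbol{n}_{\boldsymbol{i}(v)}=\boldsymbol{n}_v$ for every vertex $v$. Then the ideal $K(\mathcal{Q},\boldsymbol{i})\subset\mathcal{N}_\sigma(\mathcal{Q},\boldsymbol{i})$ of free relations for $I(\mathcal{Q},\boldsymbol{n},\boldsymbol{i})$ is zero.
   Context: A quiver $\mathcal{Q}=(\mathcal{Q}_0,\mathcal{Q}_1)$ is a finite oriented graph with vertices $\mathcal{Q}_0$ and arrows $\mathcal{Q}_1$; $a'$ and $a''$ denote the head and the tail of an arrow $a$. A path is $a=a_1\cdots a_r$ ($r\ge1$, $a_i$ arrows) with $a_1''=a_2',\ldots,a_{r-1}''=a_r'$; its head is $a'=a_1'$, its tail $a''=a_r''$; it is closed if $a'=a''$. Let $\boldsymbol{i}$ be an involution of $\mathcal{Q}_0$ without fixed points. The double quiver $\mathcal{Q}^D$ has vertices $\mathcal{Q}_0$ and arrows $\mathcal{Q}_1\sqcup\{a^T\mid a\in\mathcal{Q}_1\}$, where $(a^T)'=\boldsymbol{i}(a'')$ and $(a^T)''=\boldsymbol{i}(a')$. Put $(a^T)^T=a$ and $(a_1\cdots a_r)^T=a_r^T\cdots a_1^T$ for paths in $\mathcal{Q}^D$. For closed paths, $a\stackrel{c}{\sim}b$ means that $b$ is a cyclic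 permutation of $a$, and $a\sim b$ means $a\stackrel{c}{\sim}b$ or $a\stackrel{c}{\sim}b^T$. A closed path is primitive if it is not a power of a shorter closed path; $\mathcal{N}(\mathcal{Q},\boldsymbol{i})$ is the set of primitive closed paths in $\mathcal{Q}^D$. $\mathcal{N}_\sigma(\mathcal{Q},\boldsymbol{i})$ is the commutative polynomial ring with unity over $\mathbb{F}$ freely generated by symbols $\sigma_t(a)$, $t>0$, where $a\in\mathcal{N}(\mathcal{Q},\boldsymbol{i})$ ranges over $\sim$-classes. For a dimension vector $\boldsymbol{m}=(\boldsymbol{m}_v\mid v\in\mathcal{Q}_0)$ with $\boldsymbol{m}_{\boldsymbol{i}(v)}=\boldsymbol{m}_v$, let $R=\mathbb{F}[x^a_{ij}\mid a\in\mathcal{Q}_1,1\le i\le\boldsymbol{m}_{a'},1\le j\le\boldsymbol{m}_{a''}]$ be the coordinate ring of $H=\bigoplus_{a\in\mathcal{Q}_1}\mathbb{F}^{\boldsymbol{m}_{a'}\times\boldsymbol{m}_{a''}}$, with generic matrices $X_a=(x^a_{ij})$, $X_{a^T}=X_a^T$, and $X_{a_1\cdots a_r}=X_{a_1}\cdots X_{a_r}$ for paths in $\mathcal{Q}^D$. The group $GL(\boldsymbol{m},\boldsymbol{i})=\{(g_v)\in\prod_vGL(\boldsymbol{m}_v)\mid g_vg_{\boldsymbol{i}(v)}^T=E\ \text{for all } v\}$ acts on $H$ by $g\cdot(h_a)=(g_{a'}h_ag_{a''}^{-1})$, hence on $R$; $I(\mathcal{Q},\boldsymbol{m},\boldsymbol{i})=R^{GL(\boldsymbol{m},\boldsymbol{i})}$.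 For an $n\times n$ matrix $X$: $\det(X+\lambda E)=\sum_{t=0}^n\lambda^{n-t}\sigma_t(X)$. The homomorphism $\Upsilon_{\boldsymbol{m}}:\mathcal{N}_\sigma(\mathcal{Q},\boldsymbol{i})\to I(\mathcal{Q},\boldsymbol{m},\boldsymbol{i})$ sends $\sigma_t(a)$ to $\sigma_t(X_a)$ if $t\le\boldsymbol{m}_{a'}$ and to $0$ otherwise; $K_{\boldsymbol{m}}(\mathcal{Q},\boldsymbol{i})=\ker\Upsilon_{\boldsymbol{m}}$. The ideal of free relations is $K(\mathcal{Q},\boldsymbol{i})=\bigcap_{\boldsymbol{m}>0}K_{\boldsymbol{m}}(\mathcal{Q},\boldsymbol{i})$, over all dimension vectors $\boldsymbol{m}$ with positive entries satisfying $\boldsymbol{m}_{\boldsymbol{i}(v)}=\boldsymbol{m}_v$ for all $v$. *)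

(* Defs.v *)
From HB Require Import structures.
From mathcomp Require Import all_boot all_order all_algebra.
From mathcomp Require Import finmap zify.
From mathcomp.multinomials Require Import monalg.
From mathcomp Require Import boolp classical_sets cardinality.

Set Implicit Arguments.
Unset Strict Implicit.
Unset Printing Implicit Defensive.

Import GRing.Theory.
Local Open Scope ring_scope.
Local Open Scope quotient_scope.
Local Open Scope classical_set_scope.

(* The commutative polynomial ring F[x_i | i in I] over an arbitrary (possibly
   infinite) set I of variables is {malg F[{cmonom I}]}. *)
Notation polyring F I := {malg F[{cmonom I}]}.

Section PolynomialRing.

Definition pvar (F : fieldType) (I : choiceType) (i : I) : polyring F I :=
  << ucm i >>.

Variables (I : choiceType) (S : comNzRingType) (v : I -> S).

Definition meval (m : {cmonom I}) : S := \prod_(i <- finsupp m) v i ^+ m i.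

Lemma mevalEw (d : {fset I}) (m : {cmonom I}) : (finsupp m `<=` d)%fset ->
  meval m = \prod_(i <- d) v i ^+ m i.
Proof.
move=> sub; rewrite /meval; apply: big_fset_incl => // i _.
by rewrite -cmE_eq0 => /eqP ->; rewrite expr0.
Qed.

Lemma meval_mmorphism : mmorphism meval.
Proof.
split=> [m1 m2|]; last by rewrite /meval mdom1 big_seq_fset0.
rewrite (mevalEw (fsubsetUl (finsupp m1) (finsupp m2))).
rewrite (mevalEw (fsubsetUr (finsupp m1) (finsupp m2))).
rewrite {1}/meval mdomD -big_split /=.
by apply: eq_bigr => i _; rewrite cmM exprD.
Qed.

HB.instance Definition _ := monalg.isMultiplicative.Build {cmonom I} S meval
  meval_mmorphism.

End PolynomialRing.


(* The homomorphism of F-algebras from F[x_i | i in I] to S with x_i |-> v i. *)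
Definition peval (F : fieldType) (I : choiceType) (S : comAlgType F)
    (v : I -> S) : polyring F I -> S :=
  mmap (in_alg S) (meval v).

HB.instance Definition _ F I S v :=
  GRing.RMorphism.copy (@peval F I S v) (mmap (in_alg S) (meval v)).

Lemma pevalC (F : fieldType) (I : choiceType) (S : comAlgType F) (v : I -> S)
  c :
  peval v (c%:MP : polyring F I) = c%:A.
Proof. exact: mmapC. Qed.

Lemma peval_var (F : fieldType) (I : choiceType) (S : comAlgType F)
  (v : I -> S) i : peval v (pvar F i) = v i.
Proof.
rewrite /peval mmapU; set c := (X in X * _); have -> : c = 1 by exact: scale1r.
rewrite mul1r /meval mdomU big_seq_fset1.
by rewrite cmUU expr1.
Qed.

Lemma eq_peval (F : fieldType) (I : choiceType) (S : comAlgType F)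
    (v w : I -> S) (p : polyring F I) : v =1 w -> peval v p = peval w p.
Proof. by move=> /funext ->. Qed.

Lemma rmorph_peval (F : fieldType) (I : choiceType) (S T : comAlgType F)
    (f : {rmorphism S -> T}) (v : I -> S) (p : polyring F I) :
  (forall c : F, f c%:A = c%:A) -> f (peval v p) = peval (fun i => f (v i)) p.
Proof.
move=> fC; rewrite /peval !mmapE rmorph_sum; apply: eq_bigr => k _.
rewrite rmorphM /= fC rmorph_prod; congr (_ * _).
by apply: eq_bigr => i _; rewrite rmorphXn.
Qed.

Record quiver := Quiver {
  vertex : finType;
  arrow : finType;
  head : arrow -> vertex;
  tail : arrow -> vertex
}.

Section Paths.

Variable Q : quiver.
Implicit Types s : seq (arrow Q).

Definition composable : rel (arrow Q) := fun a b => tail a == head b.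

Definition closed_path s := (s != [::]) && cycle composable s.

(* s is closed and is not a power b^k of a closed path b of length d < size s;
   such a b is necessarily the prefix of s of length d. *)
Definition primitive s :=
  closed_path s &&
  ~~ [exists d : 'I_(size s), closed_path (take d s) &&
        (s == flatten (nseq (size s %/ d) (take d s)))].

Lemma primitiveP s :
  reflect (closed_path s /\
           ~ exists b k, [/\ closed_path b, (size b < size s)%N
                          & s = flatten (nseq k b)])
          (primitive s).
Proof.
apply: (iffP andP) => -[cs ns]; split=> //.
  move=> [b [k [cb lt_bs def_s]]]; case/existsP: ns; exists (Ordinal lt_bs).
  have b_gt0 : (0 < size b)%N by case: (b) cb.
  case: k => [|k] in def_s; first by rewrite def_s in cs.
  have -> /= : take (size b) s = b by rewrite def_s /= take_size_cat.
  rewrite cb [in size s]def_s size_flatten /shape map_nseq sumn_nseq.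
  by rewrite mulKn // -def_s eqxx.
apply/existsP => -[d /andP[cd /eqP def_s]]; apply: ns.
exists (take d s), (size s %/ d)%N; split=> //.
by rewrite size_take ltn_ord ltn_ord.
Qed.

(* Equality up to cyclic permutation. *)
Definition cyc_eq s s' := [exists k : 'I_(size s).+1, s' == rot k s].

Lemma cyc_eqP s s' : reflect (exists k, s' = rot k s) (cyc_eq s s').
Proof.
apply: (iffP existsP) => [[k /eqP ->]|[k ->]]; first by exists k.
case: (leqP k (size s)) => [le_ks | /ltnW le_sk].
  by exists (Ordinal (le_ks : (k < (size s).+1)%N)).
by exists ord0; rewrite rot0 rot_oversize.
Qed.

Lemma cyc_eq_refl : reflexive cyc_eq.
Proof. by move=> s; apply/cyc_eqP; exists 0%N; rewrite rot0. Qed.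

Lemma cyc_eq_sym : symmetric cyc_eq.
Proof.
suff sym s s' : cyc_eq s s' -> cyc_eq s' s.
  by move=> s s'; apply/idP/idP; apply: sym.
case/cyc_eqP=> k ->; apply/cyc_eqP; exists (size (rot k s) - k)%N.
by have := rotK k s; rewrite /rotr.
Qed.

Lemma cyc_eq_trans : transitive cyc_eq.
Proof.
move=> s2 s1 s3 /existsP[[k lk] /eqP ->] /existsP[[l ll] /eqP ->] /=.
rewrite ltnS size_rot in ll.
by apply/cyc_eqP; rewrite rot_add_mod //; eexists.
Qed.

End Paths.

Section DoubleQuiver.

Variables (Q : quiver) (i : vertex Q -> vertex Q).

(* inl a is the arrow a of Q and inr a is the arrow a^T. *)
Definition double_quiver := {|
  vertex := vertex Q;
  arrow := (arrow Q + arrow Q)%type;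
  head := fun b => match b with inl a => head a | inr a => i (tail a) end;
  tail := fun b => match b with inl a => tail a | inr a => i (head a) end
|}.

Definition arrowT (b : arrow double_quiver) : arrow double_quiver :=
  match b with inl a => inr a | inr a => inl a end.

Definition pathT (s : seq (arrow double_quiver)) := rev (map arrowT s).

Lemma pathTK : involutive pathT.
Proof.
by move=> s; rewrite /pathT map_rev revK -map_comp map_id_in // => -[].
Qed.

(* N(Q, i) *)
Definition Npath := {s : seq (arrow double_quiver) | primitive s}.

Definition path_sim (s s' : seq (arrow double_quiver)) :=
  cyc_eq s s' || cyc_eq s (pathT s').

Lemma cyc_eqT s s' : cyc_eq (pathT s) (pathT s') = cyc_eq s s'.
Proof.
suff H a b : cyc_eq a b -> cyc_eq (pathT a) (pathT b).
  by apply/idP/idP => [/H|/H//]; rewrite !pathTK.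
case/cyc_eqP=> k ->; rewrite cyc_eq_sym; apply/cyc_eqP; exists k.
by rewrite /pathT map_rot rev_rot rotrK.
Qed.

Lemma path_sim_refl : reflexive path_sim.
Proof. by move=> s; rewrite /path_sim cyc_eq_refl. Qed.

Lemma path_sim_sym : symmetric path_sim.
Proof.
move=> a b; rewrite /path_sim (cyc_eq_sym a b) -(cyc_eqT a) pathTK.
by rewrite (cyc_eq_sym _ b).
Qed.

Lemma path_sim_trans : transitive path_sim.
Proof.
move=> b a c /orP[ab|ab] /orP[bc|bc]; apply/orP.
- by left; apply: cyc_eq_trans bc.
- by right; apply: cyc_eq_trans bc.
- by right; apply: cyc_eq_trans ab _; rewrite cyc_eqT.
by left; apply: cyc_eq_trans ab _; rewrite -cyc_eqT pathTK.
Qed.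

Definition Nsim : rel Npath := fun a b => path_sim (val a) (val b).

Lemma Nsim_refl : reflexive Nsim. Proof. by move=> a; apply: path_sim_refl. Qed.
Lemma Nsim_sym : symmetric Nsim. Proof. by move=> a b; apply: path_sim_sym. Qed.
Lemma Nsim_trans : transitive Nsim.
Proof. by move=> b a c; apply: path_sim_trans. Qed.

Canonical Nsim_equiv := EquivRel Nsim Nsim_refl Nsim_sym Nsim_trans.

Definition Nclass := {eq_quot Nsim}.

HB.instance Definition _ := Choice.on Nclass.
HB.instance Definition _ := Quotient.on Nclass.

(* The pair (c, t) stands for the free generator sigma_t(a), a in c. *)
Definition Ngen := (Nclass * {t : nat | (0 < t)%N})%type.

HB.instance Definition _ := Choice.on Ngen.

(* A dimension vector m with m_{i(v)} = m_v for all v. *)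
Record dimvec := DimVec {
  dim :> vertex Q -> nat;
  dimP : forall v, dim (i v) = dim v
}.

End DoubleQuiver.

Notation Nsigma F i := (polyring F (Ngen i)).

(* det (X + lambda E) = \sum_(0 <= t <= n) lambda^(n-t) sigma t X, t <= n *)
Definition sigma (R : comNzRingType) n (t : nat) (X : 'M[R]_n) : R :=
  (\det (map_mx polyC X + 'X%:M))`_(n - t).

Section SigmaFacts.

Variable R : comNzRingType.

Definition cut_sigma n t (A : 'M[R]_n) : R :=
  if (t <= n)%N then sigma t A else 0.

Lemma cut_sigmaC p q t (A : 'M[R]_(p, q)) (B : 'M[R]_(q, p)) :
  cut_sigma t (A *m B) = cut_sigma t (B *m A).
Proof.
have swap : 'X^q * \det (map_mx polyC (A *m B) + 'X%:M) =
            'X^p * \det (map_mx polyC (B *m A) + 'X%:M) :> {poly R}.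
  rewrite !map_mxM /=; set a := map_mx _ A; set b := map_mx _ B.
  pose M := block_mx 'X%:M (- a) b 1%:M.
  have detM : \det M = \det (a *m b + 'X%:M).
    have : M *m block_mx 1%:M 0 (- b) 1%:M =
           block_mx (a *m b + 'X%:M) (- a) 0 1%:M.
      rewrite mulmx_block !mulmx1 !mulmx0 !mul1mx !mulmxN !mulNmx ?opprK.
      by rewrite subrr !add0r addrC.
    move/(congr1 determinant); rewrite det_mulmx det_lblock det_ublock !det1.
    by rewrite !mulr1.
  have : block_mx 1%:M 0 (- b) 'X%:M *m M =
         block_mx 'X%:M (- a) 0 (b *m a + 'X%:M).
    rewrite mulmx_block !mulmx1 !mul0mx !mul1mx !mulmxN !mulNmx ?opprK !addr0.
    by rewrite mul_mx_scalar mul_scalar_mx addNr.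
  move/(congr1 determinant); rewrite det_mulmx det_lblock det_ublock det1 mul1r.
  by rewrite !det_scalar detM.
have coefE := congr1 (fun f : {poly R} => f`_(p + q - t)) swap.
rewrite /= !coefXnM in coefE; rewrite /cut_sigma /sigma.
case: leqP => [le_tp|lt_pt]; case: leqP => [le_tq|lt_qt] //.
- move: coefE; have -> : (p + q - t < q)%N = false by lia.
  have -> : (p + q - t < p)%N = false by lia.
  have -> : (p + q - t - q = p - t)%N by lia.
  by have -> : (p + q - t - p = q - t)%N by lia.
- move: coefE; have -> : (p + q - t < q)%N = false by lia.
  have -> : (p + q - t < p)%N by lia.
  by have -> : (p + q - t - q = p - t)%N by lia.
- move: coefE; have -> : (p + q - t < q)%N by lia.
  have -> : (p + q - t < p)%N = false by lia.
  by have -> : (p + q - t - p = q - t)%N by lia.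
Qed.

Lemma cut_sigma_tr n t (A : 'M[R]_n) : cut_sigma t A^T = cut_sigma t A.
Proof.
rewrite /cut_sigma /sigma -[in RHS]det_tr linearD /= tr_scalar_mx.
by rewrite map_trmx.
Qed.

End SigmaFacts.

(* Equality of matrices up to casts of the dimensions. *)
Section CastEquality.

Variable R : comNzRingType.
Definition mxeq p q p' q' (A : 'M[R]_(p, q)) (B : 'M[R]_(p', q')) :=
  exists e : (p = p') * (q = q'), castmx e A = B.

Lemma mxeq_refl p q (A : 'M_(p, q)) : mxeq A A.
Proof. by exists (erefl, erefl); rewrite castmx_id. Qed.

Lemma mxeq_sym p q p' q' (A : 'M_(p, q)) (B : 'M_(p', q')) :
  mxeq A B -> mxeq B A.
Proof. by case=> -[e1 e2] <-; subst; rewrite castmx_id; apply: mxeq_refl. Qed.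

Lemma mxeq_trans p q p' q' p2 q2 (A : 'M_(p, q)) (B : 'M_(p', q'))
  (C : 'M_(p2, q2)) : mxeq A B -> mxeq B C -> mxeq A C.
Proof. by case=> -[e1 e2] <-; subst; rewrite castmx_id. Qed.

Lemma mxeq_eq p q (A B : 'M_(p, q)) : mxeq A B -> A = B.
Proof. by case=> e <-; rewrite castmx_id. Qed.

Lemma mxeq_cast p q p' q' e (A : 'M_(p, q)) :
  mxeq (castmx e A : 'M_(p', q')) A.
Proof. by case: e => e1 e2; subst; rewrite castmx_id; apply: mxeq_refl. Qed.

Lemma mxeq_conformL p q p' q' p2 q2 (A : 'M_(p, q)) (B : 'M_(p2, q2)) :
  p = p' -> q = q' -> mxeq A B -> mxeq (conform_mx (0 : 'M_(p', q')) A) B.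
Proof. by move=> e1 e2; subst; rewrite conform_mx_id. Qed.

Lemma mxeq_conformR p q p' q' p2 q2 (A : 'M_(p, q)) (B : 'M_(p2, q2)) :
  p = p' -> q = q' -> mxeq B A -> mxeq B (conform_mx (0 : 'M_(p', q')) A).
Proof. by move=> e1 e2; subst; rewrite conform_mx_id. Qed.

Lemma conform_mulmx p q r p' (A : 'M[R]_(p, q)) (B : 'M_(q, r)) : p = p' ->
  conform_mx (0 : 'M_(p', r)) (A *m B) = conform_mx (0 : 'M_(p', q)) A *m B.
Proof. by move=> e; subst; rewrite !conform_mx_id. Qed.

Lemma mxeq_mul p q r p' q' r' (A : 'M_(p, q)) (B : 'M_(q, r))
    (A' : 'M_(p', q')) (B' : 'M_(q', r')) :
  mxeq A A' -> mxeq B B' -> mxeq (A *m B) (A' *m B').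
Proof.
case=> -[e1 e2] <- [[e3 e4] <-]; subst; rewrite !castmx_id; exact: mxeq_refl.
Qed.

Lemma mxeq_tr p q p' q' (A : 'M_(p, q)) (B : 'M_(p', q')) :
  mxeq A B -> mxeq A^T B^T.
Proof. by case=> -[e1 e2] <-; subst; rewrite castmx_id; apply: mxeq_refl. Qed.

Lemma mxeq_cut_sigma n n' t (A : 'M_n) (B : 'M_n') :
  mxeq A B -> cut_sigma t A = cut_sigma t B.
Proof. by case=> -[e1 e2] <-; subst; rewrite castmx_id. Qed.

End CastEquality.

Lemma mxeq_map_tr (R S : comNzRingType) (f : R -> S) p q p' q'
    (A : 'M[R]_(p, q)) (B : 'M[R]_(p', q')) :
  mxeq A B^T -> mxeq (map_mx f A) (map_mx f B)^T.
Proof.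
case=> -[e1 e2] e; subst; move: e; rewrite castmx_id => ->.
by rewrite map_trmx; apply: mxeq_refl.
Qed.

Lemma mxeq_inv (S : comUnitRingType) n n' (A : 'M[S]_n) (B : 'M[S]_n') :
  mxeq A B -> mxeq (invmx A) (invmx B).
Proof.
by case=> -[e1 e2] <-; subst; rewrite castmx_id; exists (erefl, erefl);
  rewrite castmx_id.
Qed.

Section PathMatrices.

Variables (Q : quiver) (i : vertex Q -> vertex Q) (m : dimvec i).
Variables (R : comNzRingType).
Variable X : forall a : arrow Q, 'M[R]_(m (head a), m (tail a)).

Definition arrowmx (b : arrow (double_quiver i)) :
    'M[R]_(m (head b), m (tail b)) :=
  match b with
  | inl a => X a
  | inr a => castmx (esym (dimP m (tail a)), esym (dimP m (head a))) (X a)^T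
  end.

(* X_{b s_1 ... s_r}; conform_mx only casts between the (equal) dimensions at
   tail b and at the head of s_1. *)
Fixpoint pathmx (b : arrow (double_quiver i))
    (s : seq (arrow (double_quiver i))) :
    'M[R]_(m (head b), m (tail (last b s))) :=
  match s with
  | [::] => arrowmx b
  | c :: s' => arrowmx b *m conform_mx 0 (pathmx c s')
  end.

Definition closedmx (b : arrow (double_quiver i)) s : 'M[R]_(m (head b)) :=
  conform_mx 0 (pathmx b s).

Definition sigma_path t (s : seq (arrow (double_quiver i))) : R :=
  match s with
  | [::] => 0
  | b :: s' => if (t <= m (head b))%N then sigma t (closedmx b s') else 0
  end.

Notation arrowD := (arrow (double_quiver i)).
Implicit Types (b c : arrowD) (s : seq arrowD).

Lemma mxeq_tail_head b c n (A : 'M_(_, n)) : composable b c ->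
  mxeq (conform_mx (0 : 'M[R]_(m (tail b), n)) (A : 'M_(m (head c), n))) A.
Proof.
by move=> /eqP e; apply: mxeq_conformL (mxeq_refl _); rewrite ?e.
Qed.

Lemma pathmx_cat b s c s' : path (@composable _) b (s ++ c :: s') ->
  mxeq (pathmx b (s ++ c :: s'))
    (pathmx b s *m conform_mx (0 : 'M_(_, m (tail (last c s')))) (pathmx c s')).
Proof.
elim: s b => [|d s IHs] b /=; first by move=> _; apply: mxeq_refl.
case/andP=> bd /IHs {}IHs; rewrite -mulmxA.
apply: mxeq_mul (mxeq_refl _) _.
apply: mxeq_trans (mxeq_tail_head _ bd) _; apply: mxeq_trans IHs _.
apply: mxeq_mul (mxeq_refl _).
exact: mxeq_sym (mxeq_tail_head _ bd).
Qed.

Lemma closedmx_cat b u c w : cycle (@composable _) (b :: u ++ c :: w) ->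
  let A := conform_mx (0 : 'M_(m (head b), m (head c))) (pathmx b u) in
  let B := conform_mx (0 : 'M_(m (head c), m (head b))) (pathmx c w) in
  mxeq (closedmx b (u ++ c :: w)) (A *m B).
Proof.
rewrite /= rcons_path last_cat cat_path /= => /andP[/and3P[pu uc pw] wb].
have {}wb : tail (last c w) = head b by apply/eqP.
apply: mxeq_conformL; rewrite ?last_cat ?last_cons ?wb //.
apply: mxeq_trans (pathmx_cat _) _; first by rewrite cat_path /= pu uc.
have {}uc : tail (last b u) = head c by apply/eqP.
apply: mxeq_mul; first by apply: mxeq_conformR (mxeq_refl _); rewrite ?uc.
apply: mxeq_conformL; rewrite ?uc //.
by apply: mxeq_conformR (mxeq_refl _); rewrite ?wb.
Qed.

Lemma sigma_path_catC t u w : closed_path (u ++ w) ->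
  sigma_path t (w ++ u) = sigma_path t (u ++ w).
Proof.
case: u w => [|b u] [|c w]; rewrite ?cats0 // => /andP[_ cs].
have cs' : cycle (@composable _) (c :: w ++ b :: u).
  by move: cs; rewrite -(rot_cycle (size (b :: u))) rot_size_cat.
rewrite -[LHS]/(cut_sigma t (closedmx c (w ++ b :: u))).
rewrite -[RHS]/(cut_sigma t (closedmx b (u ++ c :: w))).
by rewrite !(mxeq_cut_sigma _ (closedmx_cat _)) // cut_sigmaC.
Qed.

Lemma sigma_path_cyc t s s' : closed_path s -> cyc_eq s s' ->
  sigma_path t s' = sigma_path t s.
Proof.
move=> cs /cyc_eqP[k ->]; rewrite /rot -{3}(cat_take_drop k s).
by apply: sigma_path_catC; rewrite cat_take_drop.
Qed.

Hypothesis iK : involutive i.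

Lemma head_arrowT b : head (arrowT b) = i (tail b).
Proof. by case: b => a //=; rewrite iK. Qed.

Lemma tail_arrowT b : tail (arrowT b) = i (head b).
Proof. by case: b => a //=; rewrite iK. Qed.

Lemma composableT b c : composable (arrowT c) (arrowT b) = composable b c.
Proof.
by rewrite /composable head_arrowT tail_arrowT (can_eq iK) eq_sym.
Qed.

Lemma arrowmx_T b : mxeq (arrowmx (arrowT b)) (arrowmx b)^T.
Proof.
case: b => a /=; first exact: mxeq_cast.
by apply: mxeq_sym; rewrite -[X in mxeq _ X]trmxK; apply/mxeq_tr/mxeq_cast.
Qed.

Lemma pathmx_T b s b' s' : path (@composable _) b s ->
  pathT (b :: s) = b' :: s' -> mxeq (pathmx b' s') (pathmx b s)^T.
Proof.
elim: s b b' s' => [|c s IHs] b b' s' /=.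
  by rewrite /pathT /= => _ [<- <-]; apply: arrowmx_T.
case/andP=> bc cs; rewrite /pathT map_cons rev_cons.
case defT: (rev _) => [|d u] /=.
  by move/(congr1 size): defT; rewrite size_rev.
case=> <- <-; have {}IHs := IHs _ _ _ cs defT.
have lastu : last d u = arrowT c.
  by rewrite -[LHS]/(last d (d :: u)) -defT /= rev_cons last_rcons.
have pdu : path (@composable _) d u.
  rewrite -[path _ _ _]/(sorted (@composable _) (d :: u)) -defT rev_sorted.
  rewrite sorted_map; move: cs; apply: sub_path => x y /=.
  by rewrite composableT.
rewrite -cats1; apply: mxeq_trans (pathmx_cat _) _.
  by rewrite cat_path pdu lastu /= composableT bc.
rewrite trmx_mul; apply: mxeq_mul.
  apply: mxeq_trans IHs _; apply: mxeq_tr; apply: mxeq_sym.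
  exact: mxeq_tail_head.
apply: mxeq_conformL (arrowmx_T b) => //.
by rewrite lastu head_arrowT tail_arrowT !dimP (eqP bc).
Qed.

Lemma sigma_path_T t s : closed_path s ->
  sigma_path t (pathT s) = sigma_path t s.
Proof.
case: s => // b s /andP[_]; rewrite /= rcons_path => /andP[pbs sb].
case defT: (pathT (b :: s)) => [|c u].
  by move/(congr1 size): defT; rewrite size_rev.
have cuT := pathmx_T pbs defT.
have lastu : last c u = arrowT b.
  by rewrite -[LHS]/(last c (c :: u)) -defT /pathT /= rev_cons last_rcons.
have headc : head c = i (tail (last b s)).
  rewrite -head_arrowT -last_map; move: defT.
  by rewrite /pathT map_cons lastI rev_rcons => -[->].
rewrite -[LHS]/(cut_sigma t (closedmx c u)).
rewrite -[RHS]/(cut_sigma t (closedmx b s)) -[RHS]cut_sigma_tr.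
apply: mxeq_cut_sigma; apply: mxeq_conformL => //.
  by rewrite lastu tail_arrowT headc (eqP sb).
apply: mxeq_trans cuT _; apply: mxeq_tr.
by apply: mxeq_conformR; rewrite ?(eqP sb) //; apply: mxeq_refl.
Qed.

(* sigma_t(X_a) only depends on the ~-class of a. *)
Lemma sigma_path_sim t s s' : closed_path s -> closed_path s' ->
  path_sim s s' -> sigma_path t s = sigma_path t s'.
Proof.
move=> cs cs' /orP[] /(sigma_path_cyc t cs) <- //.
by rewrite sigma_path_T.
Qed.

End PathMatrices.

Lemma eq_sigma_path (Q : quiver) (i : vertex Q -> vertex Q) (m : dimvec i)
    (R : comNzRingType)
    (X Y : forall a : arrow Q, 'M[R]_(m (head a), m (tail a))) t s :
  (forall a, X a = Y a) -> sigma_path X t s = sigma_path Y t s.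
Proof.
by move=> XY; have -> : X = Y by apply/functional_extensionality_dep.
Qed.

Lemma sigma_path_map (Q : quiver) (i : vertex Q -> vertex Q) (m : dimvec i)
    (R S : comNzRingType) (f : {rmorphism R -> S})
    (X : forall a : arrow Q, 'M[R]_(m (head a), m (tail a))) t s :
  f (sigma_path X t s) = sigma_path (fun a => map_mx f (X a)) t s.
Proof.
case: s => [|b s] /=; first exact: rmorph0.
case: ifP => _; last exact: rmorph0.
rewrite /sigma -coef_map -det_map_mx map_mxD map_scalar_mx /= map_polyX.
have -> : closedmx (fun a => map_mx f (X a)) b s = map_mx f (closedmx X b s).
  rewrite /closedmx map_conform_mx raddf0; congr conform_mx.
  elim: s b => [|c s IHs] b.
    by case: b => a //=; rewrite map_castmx map_trmx.
  by rewrite /= map_mxM map_conform_mx raddf0 IHs; case: b => a //=;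
    rewrite map_castmx map_trmx.
congr (polyseq (\det (_ + _)))`_ _.
by apply/matrixP => k l; rewrite !mxE map_polyC.
Qed.

Section Gauge.

Variables (Q : quiver) (i : vertex Q -> vertex Q) (m : dimvec i).
Variables (R : comNzRingType) (g h : forall v, 'M[R]_(m v)).
Variable X : forall a : arrow Q, 'M[R]_(m (head a), m (tail a)).

Hypothesis gh : forall v, g v *m h v = 1%:M.
Hypothesis hT : forall v, mxeq (h (i v)) (g v)^T.
Hypothesis gT : forall v, mxeq (g (i v)) (h v)^T.

Let X' a := h (head a) *m X a *m g (tail a).

Lemma arrowmx_gauge (b : arrow (double_quiver i)) :
  arrowmx X' b = h (head b) *m arrowmx X b *m g (tail b).
Proof.
case: b => a //; apply: mxeq_eq; apply: mxeq_trans (mxeq_cast _ _) _.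
rewrite /X' !trmx_mul mulmxA; apply: mxeq_mul (mxeq_sym (gT _)).
by apply: mxeq_mul (mxeq_sym (hT _)) (mxeq_sym (mxeq_cast _ _)).
Qed.

Lemma conform_gauge u v n (A : 'M_(m v, n)) : u = v ->
  g u *m conform_mx (0 : 'M_(m u, n)) (h v *m A) = conform_mx 0 A.
Proof. by move=> ->; rewrite !conform_mx_id mulmxA gh mul1mx. Qed.

Lemma pathmx_gauge (b : arrow (double_quiver i)) s :
  path (@composable _) b s ->
  pathmx X' b s = h (head b) *m pathmx X b s *m g (tail (last b s)).
Proof.
elim: s b => [|c s IHs] b; first by rewrite -arrowmx_gauge.
move=> /= /andP[/eqP bc /IHs ->]; rewrite arrowmx_gauge -!mulmxA.
rewrite (conform_gauge _ bc); do 2!congr (_ *m _).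
by apply: conform_mulmx; rewrite bc.
Qed.

Lemma sigma_path_gauge t s :
  closed_path s -> sigma_path X' t s = sigma_path X t s.
Proof.
case: s => [|b s]; first by [].
case/andP=> _ cs; have {cs} : path (@composable _) b (rcons s b) := cs.
rewrite rcons_path => /andP[ps /eqP e].
rewrite -[LHS]/(cut_sigma t (closedmx X' b s)).
rewrite -[RHS]/(cut_sigma t (closedmx X b s)).
have -> : closedmx X' b s = h (head b) *m (closedmx X b s *m g (head b)).
  rewrite /closedmx pathmx_gauge //; move: (pathmx X b s); rewrite e => A.
  by rewrite !conform_mx_id mulmxA.
by rewrite cut_sigmaC -mulmxA gh mulmx1.
Qed.

End Gauge.

Section Invariants.

Variables (F : fieldType) (Q : quiver) (i : vertex Q -> vertex Q).

Section FixedDimension.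

Variable m : dimvec i.

Definition coord :=
  {a : arrow Q & ('I_(m (head a)) * 'I_(m (tail a)))%type}.

HB.instance Definition _ := Choice.on coord.

Definition coord_ring := {malg F[{cmonom coord}]}.

HB.instance Definition _ := GRing.ComAlgebra.on coord_ring.

Definition genericmx a : 'M[coord_ring]_(m (head a), m (tail a)) :=
  \matrix_(k, l) pvar F (Tagged _ (k, l) : coord).

(* sigma_t(a) is evaluated at a chosen representative of the class of a;
   Upsilon_sigma shows that every representative gives the same value. *)
Definition Upsilon : Nsigma F i -> coord_ring :=
  peval (fun x : Ngen i =>
    sigma_path genericmx (val x.2) (val (repr x.1))).

HB.instance Definition _ := GRing.RMorphism.on Upsilon.

(* GL(m, i) *)
Definition GLmi : set (forall v, 'M[F]_(m v)) :=
  [set g | (forall v, g v \in unitmx) /\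
     forall v, g v *m castmx (dimP m v, dimP m v) (g (i v))^T = 1%:M].

(* The action on functions on H, (g . f) h = f (g^-1 . h), in coordinates. *)
Definition act_coord (g : forall v, 'M[F]_(m v)) : coord_ring -> coord_ring :=
  peval (fun x : coord =>
    (map_mx (@malgC _ _) (invmx (g (head (tag x)))) *m genericmx (tag x)
       *m map_mx (@malgC _ _) (g (tail (tag x)))) (tagged x).1 (tagged x).2).

HB.instance Definition _ g := GRing.RMorphism.on (act_coord g).

(* I(Q, m, i) *)
Definition invariants : set coord_ring :=
  [set f | forall g, GLmi g -> act_coord g f = f].

Lemma Upsilon_sigma (iK : involutive i) (a : Npath i) t :
  Upsilon (pvar F (\pi_(Nclass i) a, t)) = sigma_path genericmx (val t) (val a).
Proof.
rewrite /Upsilon peval_var /=; apply: sigma_path_sim => //.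
- by case/andP: (valP (repr (\pi_(Nclass i) a))).
- by case/andP: (valP a).
have /eqmodP : repr (\pi_(Nclass i) a) = a %[mod Nclass i] by rewrite reprK.
by [].
Qed.

Lemma Upsilon_invariant f : invariants (Upsilon f).
Proof.
move=> g [gU gT]; rewrite /Upsilon.
have actC c : act_coord g c%:A = c%:A :> coord_ring.
  have C1 : c%:A = c%:MP :> coord_ring by rewrite -mul_malgC mulr1.
  by rewrite [in LHS]C1 /act_coord pevalC.
rewrite (rmorph_peval (f := act_coord g) _ _ actC).
apply: eq_peval => x; rewrite sigma_path_map.
set s := val (repr _); have cs : closed_path s.
  by case/andP: (valP (repr x.1)).
pose C n (A : 'M[F]_n) : 'M[coord_ring]_n := map_mx (@malgC _ _) A.
have gVT v : invmx (g v) = castmx (dimP m v, dimP m v) (g (i v))^T.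
  by rewrite -[RHS]mul1mx -(mulVmx (gU v)) -mulmxA gT mulmx1.
have gh v : C _ (g v) *m C _ (invmx (g v)) = 1%:M.
  by rewrite /C -map_mxM mulmxV // map_mx1.
have gT' v : mxeq (g (i v)) (invmx (g v))^T.
  rewrite gVT; apply: mxeq_sym; rewrite -[X in mxeq _ X]trmxK.
  exact/mxeq_tr/mxeq_cast.
have hT v : mxeq (C _ (invmx (g (i v)))) (C _ (g v))^T.
  apply: mxeq_map_tr; have -> : (g v)^T = invmx (invmx (g v))^T.
    by rewrite -trmx_inv invmxK.
  exact: mxeq_inv.
have gT2 v : mxeq (C _ (g (i v))) (C _ (invmx (g v)))^T.
  exact: mxeq_map_tr.
have <- := sigma_path_gauge genericmx gh hT gT2 (sval x.2) cs.
apply: eq_sigma_path => a; apply/matrixP => k l.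
have gE : genericmx a k l = pvar F (Tagged _ (k, l) : coord) by rewrite mxE.
have -> : map_mx (act_coord g) (genericmx a) k l =
          act_coord g (genericmx a k l).
  by apply: mxE.
rewrite gE; exact: peval_var.
Qed.

(* K_m(Q, i), the kernel of Upsilon; by Upsilon_invariant it does not matter
   that Upsilon is not corestricted to the invariants. *)
Definition relations : set (Nsigma F i) := [set f | Upsilon f = 0].

End FixedDimension.

(* K(Q, i) *)
Definition free_relations : set (Nsigma F i) :=
  \bigcap_(m in [set m : dimvec i | forall v, (0 < m v)%N]) relations m.

End Invariants.

Arguments free_relations F {Q} i.

(* Main.v *)
From HB Require Import structures.
Require Import Defs.
From mathcomp Require Import all_boot all_order all_algebra all_fingroup.
From mathcomp Require Import finmap zify.
From mathcomp.multinomials Require Import monalg.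
From mathcomp Require Import boolp classical_sets cardinality.

Set Implicit Arguments.
Unset Strict Implicit.
Unset Printing Implicit Defensive.

Import GRing.Theory.
Local Open Scope ring_scope.
Local Open Scope classical_set_scope.

(** Let f be a free relation.  For each class of primitive closed paths
    occurring in f pick a representative a_j, and build one representation of
    Q over the polynomial ring N_sigma(Q, i) itself on which sigma_t(X_(a_j))
    is the variable sigma_t(a_j); evaluating f there returns f, so f = 0.

    The representation has one T-dimensional block per letter of each a_j.
    Reading a letter of a_j moves from its block to the cyclically next one,
    through a companion matrix C_j for the first letter and the identity for
    the others; this gives a matrix F_c for every arrow c of the double quiver,
    and X_c = F_c + F_(c^T)^T is compatible with transposition.  Since i has no
    fixed points, c^T is never composable with c, so the mixed products vanish
    and X_w = F_w + (F_(w^T))^T for every closed path w.  For w = a_j,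
    primitivity leaves C_j as the only diagonal block of F_w in the rows of
    a_j.  The other closed walks along w or w^T would make w a cyclic
    permutation of another a_l or of its own transpose; neither occurs, the
    latter again because i has no fixed points.  So the rest of X_w is nilpotent
    and sigma_t(X_w) = sigma_t(C_j). *)

(** * The polynomial det(A + X E) *)

Section CharPoly.

Variable R : comNzRingType.

(** This is the characteristic polynomial of [- A]; its coefficients are the values [sigma t A]. *)
Definition addX_det n (A : 'M[R]_n) : {poly R} :=
  \det (map_mx polyC A + 'X%:M).

Lemma addX_det_tr n (A : 'M[R]_n) : addX_det A^T = addX_det A.
Proof.
by rewrite /addX_det -[in RHS]det_tr linearD /= tr_scalar_mx map_trmx.
Qed.

(** When [A *m B = 0], the product (A + X)(B + X) collapses to X(A + B + X); take determinants. *)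
Lemma addX_det_mul n (A B : 'M[R]_n) : A *m B = 0 ->
  addX_det A * addX_det B = 'X^n * addX_det (A + B).
Proof.
move=> AB0; rewrite /addX_det -det_mulmx -det_scalar -det_mulmx.
congr (\det _); rewrite map_mxD mulmxDl !mulmxDr -map_mxM AB0 map_mx0 add0r.
by rewrite -!scalar_mxC addrA.
Qed.

(** In the expansion over permutations only the identity contributes: any other one either moves
    some point along a zero entry or would lower the height at every point it moves. *)
Lemma addX_det_acyclic n (A : 'M[R]_n) (ht : 'I_n -> nat) :
  (forall p q, A p q != 0 -> (ht q < ht p)%N) -> addX_det A = 'X^n.
Proof.
move=> acyc; rewrite /addX_det /determinant (bigD1 (1%g : {perm 'I_n})) //=.
rewrite odd_perm1 expr0 mul1r (eq_bigr (fun _ => 'X)) => [|p _]; last first.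
  rewrite perm1 !mxE eqxx mulr1n; case: (eqVneq (A p p) 0) => [->|/acyc].
    by rewrite add0r.
  by rewrite ltnn.
rewrite prodr_const card_ord big1 ?addr0 // => s ns1.
pose strict p := (s p != p) && (A p (s p) == 0).
case: (pickP strict) => [p /andP[sp /eqP Ap]|all_p].
  by rewrite (bigD1 p) //= !mxE Ap add0r eq_sym (negPf sp) mulr0n mul0r mulr0.
case/eqP: ns1; apply/permP => p; rewrite perm1.
have lift_le q : (ht (s q) <= ht q ?= iff (s q == q))%N.
  case: (eqVneq (s q) q) (all_p q) => [-> _|sq].
    by split; rewrite ?eqxx.
  rewrite /strict sq => /negbT/acyc lt; split; first exact: ltnW.
  by rewrite ltn_eqF.
(* Reindexing by [s] preserves the total height, so every inequality [lift_le] is an equality and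
   [s] fixes every point. *)
have [_] := leqif_sum (fun q (_ : true) => lift_le q).
rewrite -(reindex_inj (h := s) (F := ht) (P := xpredT)) //=; last first.
  exact: perm_inj.
by rewrite eqxx => /esym/forallP/(_ p)/eqP.
Qed.

Lemma addX_det_add n (A B : 'M[R]_n) :
  A *m B = 0 -> addX_det B = 'X^n -> addX_det (A + B) = addX_det A.
Proof.
move=> /addX_det_mul e detB; move: e; rewrite detB mulrC.
by move/(monic_lreg (monicXn R n)) => <-.
Qed.

Lemma cut_sigma_addX_det n t (A B : 'M[R]_n) :
  addX_det A = addX_det B -> cut_sigma t A = cut_sigma t B.
Proof. by rewrite /cut_sigma /sigma /addX_det => ->. Qed.

Lemma exists_sigma_mx n (y : nat -> R) :
  exists A : 'M[R]_n.+1, forall t, (0 < t <= n.+1)%N -> cut_sigma t A = y t.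
Proof.
pose p := \poly_(k < n.+2) (if k == n.+1 then 1 else y (n.+1 - k)%N).
have sp : size p = n.+2 by rewrite size_poly_eq //= eqxx oner_eq0.
have pm : p \is monic.
  by rewrite monicE lead_coefE sp coef_poly ltnS leqnn eqxx.
have [A detA] : exists A : 'M[R]_n.+1, addX_det A = p.
  have := companionmxK pm; move: (companionmx p); rewrite sp /= => M <-.
  (* The companion matrix satisfies det(X - M) = p, whence the sign. *)
  exists (- M); rewrite /addX_det /char_poly /char_poly_mx addrC map_mxN.
  by [].
exists A => t /andP[t0 tn]; rewrite /cut_sigma tn /sigma -/(addX_det A) detA.
rewrite coef_poly ifT ?ltnS ?leq_subr // ifF; last by apply/eqP; lia.
by congr y; lia.
Qed.

End CharPoly.

(** * Periods of cyclic words *)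

Section Words.
Local Open Scope nat_scope.

Lemma nth_flatten_nseq (T : Type) (c : T) M (w : seq T) q :
  q < M * size w -> nth c (flatten (nseq M w)) q = nth c w (q %% size w).
Proof.
elim: M q => // M IHM q; rewrite mulSn /= nth_cat.
case: (ltnP q (size w)) => [lt_q _|le_q lt_qM]; first by rewrite modn_small.
rewrite IHM; last by lia.
by rewrite -[in RHS](subnK le_q) modnDr.
Qed.

Lemma size_flatten_nseq (T : Type) M (w : seq T) :
  size (flatten (nseq M w)) = M * size w.
Proof. by rewrite size_flatten /shape map_nseq sumn_nseq mulnC. Qed.

(** Indexing into the infinite periodic word [s s s ...] turns rotations of [s] into shifts. *)
Definition cnth (T : Type) (c : T) (s : seq T) q := nth c s (q %% size s).

Lemma cnth_rot T (c : T) (s : seq T) k q : k <= size s -> q < size s ->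
  nth c (rot k s) q = cnth c s (q + k).
Proof.
move=> ks qs; rewrite /rot nth_cat size_drop nth_drop /cnth.
case: ltnP => lt; first by rewrite modn_small 1?[q + k]addnC //; lia.
rewrite nth_take; last by lia.
have -> : q + k = q - (size s - k) + size s by lia.
by rewrite modnDr modn_small //; lia.
Qed.

(** By Bezout, a multiple of [m] exceeds a multiple of [n] by exactly the gcd. *)
Lemma periodic_gcd T (h : nat -> T) m n : 0 < m ->
  (forall q, h (q + m) = h q) -> (forall q, h (q + n) = h q) ->
  forall q, h (q + gcdn m n) = h q.
Proof.
move=> m0 hm hn q.
have mult k d : (forall q, h (q + d) = h q) -> forall q, h (q + k * d) = h q.
  by move=> hd; elim: k => [|k IH] r; rewrite ?addn0 // mulSn addnA IH hd.
case: (egcdnP n m0) => u v e _.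
by rewrite -(mult v n hn) -addnA [gcdn m n + _]addnC -e mult.
Qed.

Variable Q : quiver.
Implicit Types (c : arrow Q) (s w : seq (arrow Q)).

Lemma cnth_composable c s q : closed_path s ->
  composable (cnth c s q) (cnth c s q.+1).
Proof.
case: s => // b s /andP[_ /(pathP c) cs]; rewrite /cnth.
have lt_q : q %% (size s).+1 < size (rcons s b) by rewrite size_rcons ltn_pmod.
have := cs _ lt_q; rewrite -rcons_cons nth_rcons ltn_pmod // nth_rcons.
congr (composable _ _); rewrite -(addn1 q) -modnDml addn1 /=.
have := ltn_pmod q (isT : 0 < (size s).+1); rewrite ltnS leq_eqVlt.
case/predU1P=> [->|lt]; first by rewrite ltnn eqxx modnn.
by rewrite lt [X in _ = nth _ _ X]modn_small.
Qed.

(** The gcd of [k] and the length is again a period; were it shorter than [s], the prefix of that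
    length would be a closed path with [s] as a power. *)
Lemma primitive_period c s k : primitive s ->
  (forall q, cnth c s (q + k) = cnth c s q) -> size s %| k.
Proof.
case/andP=> cs prim_s per_k.
have s0 : 0 < size s by case: (s) cs.
pose g := gcdn (size s) k.
have per_g : forall q, cnth c s (q + g) = cnth c s q.
  by apply: periodic_gcd => // q; rewrite /cnth modnDr.
have g0 : 0 < g by rewrite gcdn_gt0 s0.
have per_mod q : cnth c s (q %% g) = cnth c s q.
  rewrite [in RHS](divn_eq q g) addnC; elim: (q %/ g) => [|n IH].
    by rewrite addn0.
  by rewrite mulSnr addnA per_g.
suff: ~~ (g < size s).
  rewrite -leqNgt => le; have /eqP <- : g == size s.
    by rewrite eqn_leq le dvdn_leq // dvdn_gcdl.
  exact: dvdn_gcdr.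
apply: contra prim_s => lt_gs; apply/existsP; exists (Ordinal lt_gs) => /=.
have size_g : size (take g s) = g by rewrite size_takel // ltnW.
have nth_g q : q < g -> nth c (take g s) q = cnth c s q.
  by move=> lt_q; rewrite nth_take // /cnth modn_small // (ltn_trans lt_q).
apply/andP; split; last first.
  have eg : size s %/ g * g = size s by rewrite divnK // dvdn_gcdl.
  apply/eqP/(@eq_from_nth _ c); first by rewrite size_flatten_nseq size_g eg.
  move=> q lt_q; rewrite nth_flatten_nseq size_g ?eg // nth_g ?ltn_pmod //.
  by rewrite per_mod /cnth modn_small.
apply/andP; split; first by rewrite -size_eq0 size_g -lt0n.
case def_t: (take g s) size_g nth_g => [|b t] size_g nth_g.
  by rewrite -size_g in g0.
apply/(pathP c) => q; rewrite size_rcons => lt_q.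
have lt_qg : q < g by rewrite -size_g.
rewrite -rcons_cons nth_rcons lt_q nth_g // nth_rcons.
(* The cyclic successor inside the prefix agrees with the successor in [s]: after the last letter,
   period [g] brings back the first one. *)
have -> : (if q < size t then nth c t q else if q == size t then b else c)
    = cnth c s q.+1; last exact: cnth_composable.
move: lt_q; rewrite ltnS leq_eqVlt => /predU1P[->|lt_qt].
  rewrite ltnn eqxx -per_mod -[(size t).+1]/(size (b :: t)) size_g modnn.
  by rewrite -nth_g.
by rewrite lt_qt -nth_g // -size_g.
Qed.

(** Each length is a period of the other word, so by primitivity the lengths divide each other and
    the shift is a rotation. *)
Lemma cnth_shift_cyc c s w k : primitive s -> primitive w -> k <= size s ->
  (forall q, cnth c w q = cnth c s (q + k)) -> cyc_eq w s.
Proof.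
move=> ps pw ks sw.
have sz : size s = size w.
  apply/eqP; rewrite eqn_dvd; apply/andP; split.
    apply: (primitive_period ps (c := c)) => q.
    rewrite -[LHS]/(nth c s _) -(modnDr (q + size w)) -/(cnth c s _).
    (* A full turn of [s] leaves room to split off the shift by [k], so that [sw] applies. *)
    have -> : q + size w + size s = (q + (size s - k) + size w) + k by lia.
    rewrite -sw -[LHS]/(nth c w _) modnDr -/(cnth c w _) sw.
    by rewrite -addnA subnK // /cnth modnDr.
  apply: (primitive_period pw (c := c)) => q.
  rewrite !sw addnAC.
  by rewrite /cnth modnDr.
rewrite cyc_eq_sym; apply/cyc_eqP; exists k.
apply: (@eq_from_nth _ c); first by rewrite size_rot.
move=> q qw; rewrite cnth_rot //; last by rewrite sz.
by rewrite -sw /cnth modn_small.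
Qed.

End Words.

(** * Transposition of closed paths *)

Section TransposedWords.
Local Open Scope nat_scope.

Variables (Q : quiver) (i : vertex Q -> vertex Q).
Hypotheses (iK : involutive i) (i_nofix : forall v, i v != v).

Lemma arrowTK : involutive (@arrowT Q i).
Proof. by case. Qed.

Lemma arrowT_neq (b : arrow (double_quiver i)) : arrowT b != b.
Proof. by case: b. Qed.

(** The head of [arrowT b] is the image under [i] of the tail of [b], hence differs from that
    tail. *)
Lemma composable_arrowT (b c : arrow (double_quiver i)) :
  composable b c -> c != arrowT b.
Proof.
move=> /eqP bc; apply/eqP => ec; move: bc; rewrite ec head_arrowT //.
by move/esym/eqP; rewrite (negPf (i_nofix _)).
Qed.

Lemma cyc_eq_pathTN (w : seq (arrow (double_quiver i))) :
  closed_path w -> ~~ cyc_eq w (pathT w).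
Proof.
move=> cw; apply/existsP => -[[k /= lt_k] /eqP e].
have [c _] : exists c : arrow (double_quiver i), c \in w.
  by case: (w) cw => // c u _; exists c; rewrite mem_head.
have w0 : 0 < size w by case: (w) cw.
have TE q : q < size w -> arrowT (cnth c w (size w - q.+1)) = cnth c w (q + k).
  move=> lt_q; have := congr1 (fun u => nth c u q) e.
  rewrite cnth_rot // => <-; rewrite /pathT nth_rev ?size_map //.
  rewrite (nth_map c); last by lia.
  by rewrite /cnth modn_small //; lia.
(* The transposed reflection of w agrees with its rotation by k, so some letter
   is its own transpose (k odd) or the transpose of its successor (k even). *)
have [k0|k0] := posnP k.
  have := TE _ w0; rewrite k0 addn0 subn1 => T0.
  have /eqP[] := composable_arrowT (cnth_composable c (size w).-1 cw).
  by rewrite T0 prednK // /cnth modnn mod0n.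
have upE := uphalf_half k; have kE := odd_double_half k.
(* At [q = size w - uphalf k] the identity [TE] pairs the indices [(uphalf k).-1] and [k./2], equal
   for odd [k] and consecutive for even [k]. *)
have lt : size w - (uphalf k) < size w by have := uphalf_gt0 k; lia.
have := TE _ lt.
have -> : size w - (size w - uphalf k).+1 = (uphalf k).-1.
  move: lt lt_k upE kE (uphalf_gt0 k); rewrite k0; clear.
  by case: (odd k) => /=; move: (size w) (uphalf k) k./2; lia.
have -> : size w - uphalf k + k = k./2 + size w.
  move: lt lt_k upE kE; clear.
  by case: (odd k) => /=; move: (size w) (uphalf k) k./2; lia.
rewrite [cnth c w (k./2 + _)]/cnth modnDr -/(cnth c w _).
case/boolP: (odd k) => ok.
  have -> : (uphalf k).-1 = k./2 by lia.
  by move/eqP; rewrite (negPf (arrowT_neq _)).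
have -> : k./2 = (uphalf k).-1.+1 by lia.
by move/esym/eqP; apply/negP/composable_arrowT/cnth_composable.
Qed.

Lemma closed_path_pathT (w : seq (arrow (double_quiver i))) :
  closed_path w -> closed_path (pathT w).
Proof.
case/andP=> w0 cw; rewrite /closed_path -size_eq0 size_rev size_map size_eq0 w0.
rewrite rev_cycle cycle_map; move: cw; apply: sub_cycle => b c /=.
by rewrite composableT.
Qed.

Lemma primitive_pathT (w : seq (arrow (double_quiver i))) :
  primitive w -> primitive (pathT w).
Proof.
case/primitiveP=> cw prim_w; apply/primitiveP.
split; first exact: closed_path_pathT.
case=> b [k [cb lt_b def_w]]; apply: prim_w; exists (pathT b), k.
split; first exact: closed_path_pathT.
  by move: lt_b; rewrite !size_rev !size_map.
rewrite -[LHS](@pathTK Q i) def_w /pathT map_flatten rev_flatten.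
by rewrite map_nseq map_nseq rev_nseq.
Qed.

End TransposedWords.

(** * Matrix products along words *)

Section WordProducts.

Variables (R : comNzRingType) (n : nat) (L : Type).
Implicit Types (Z : L -> 'M[R]_n) (u : seq L).

Definition wprod Z u : 'M[R]_n := foldr (fun c => mulmx (Z c)) 1%:M u.

Lemma wprod_cat Z u v : wprod Z (u ++ v) = wprod Z u *m wprod Z v.
Proof. by elim: u => [|c u IH] /=; rewrite ?mul1mx // IH mulmxA. Qed.

Lemma eq_wprod Z Z' u : Z =1 Z' -> wprod Z u = wprod Z' u.
Proof. by move=> ZZ'; elim: u => //= c u ->; rewrite ZZ'. Qed.

Lemma wprod_tr Z u : wprod (fun c => (Z c)^T) (rev u) = (wprod Z u)^T.
Proof.
elim: u => [|c u IH]; first by rewrite /= trmx1.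
by rewrite rev_cons -cats1 wprod_cat IH /= mulmx1 trmx_mul.
Qed.

Lemma wprodD (e : rel L) Z Z' b s :
    (forall c d, e c d -> Z c *m Z' d = 0) ->
    (forall c d, e c d -> Z' c *m Z d = 0) -> path e b s ->
  wprod (fun c => Z c + Z' c) (b :: s) = wprod Z (b :: s) + wprod Z' (b :: s).
Proof.
move=> ZZ' Z'Z; elim: s b => [|c s IH] b; first by rewrite /= !mulmx1.
move=> /= /andP[bc /IH]; rewrite /= => ->; rewrite mulmxDl !mulmxDr !mulmxA.
by rewrite ZZ' // Z'Z // !mul0mx addr0 add0r.
Qed.

End WordProducts.

Lemma wprod_map (R : comNzRingType) n (L L' : Type) (f : L' -> L)
    (Z : L -> 'M[R]_n) (u : seq L') :
  wprod Z (map f u) = wprod (fun c => Z (f c)) u.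
Proof. by elim: u => //= c u ->. Qed.

(** * Block matrices that walk along cyclic words *)

Section CyclicCover.

Variables (R : comNzRingType) (T : nat) (L : eqType) (J : finType).
Variables (a : J -> seq L) (C : J -> 'M[R]_T).

Definition position := {j : J & 'I_(size (a j))}.
HB.instance Definition _ := Finite.on position.

Implicit Types (x y : position) (c : L) (u w : seq L).

Definition label x : L := tnth (in_tuple (a (tag x))) (tagged x).

Definition next x : position :=
  Tagged (fun j => 'I_(size (a j))) (ordS (tagged x)).

Lemma next_inj : injective next.
Proof.
move=> [j k] [l k'] e; have jl : j = l by have := congr1 tag e.
move: k' e; rewrite -jl => k' /eqP; rewrite eq_Tagged => /eqP /= /ordS_inj ->.
by [].
Qed.

Lemma iter_next q j (k : 'I_(size (a j))) :
  iter q next (Tagged _ k) = Tagged _ (iter q (@ordS _) k).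
Proof. by elim: q => //= q ->. Qed.

Lemma val_iter_ordS m q (k : 'I_m) :
  val (iter q (@ordS m) k) = ((q + k) %% m)%N.
Proof.
elim: q => [|q IH] /=; first by rewrite add0n modn_small.
by rewrite IH -addn1 modnDml addn1.
Qed.

Fixpoint reads x u : bool :=
  if u is c :: u' then (c == label x) && reads (next x) u' else true.

Lemma reads_cat x u v :
  reads x (u ++ v) = reads x u && reads (iter (size u) next x) v.
Proof. by elim: u x => //= c u IH x; rewrite IH -andbA -iterS iterSr. Qed.

Lemma readsP c x u :
  reads x u <->
  forall q, (q < size u)%N -> nth c u q = cnth c (a (tag x)) (q + tagged x).
Proof.
have shift y q : cnth c (a (tag (next y))) (q + tagged (next y)) =
    cnth c (a (tag y)) (q.+1 + tagged y).
  by rewrite /cnth /=; congr nth; rewrite modnDmr addnS.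
have labelE y : label y = cnth c (a (tag y)) (tagged y).
  by rewrite /label (tnth_nth c) /cnth modn_small.
elim: u x => // d u IH x /=; split=> [/andP[/eqP dx /IH ru] [|q] /= lt_q | ru].
- by rewrite dx labelE.
- by rewrite ru // shift.
apply/andP; split; first by apply/eqP; rewrite labelE -(ru 0%N).
by apply/IH => q lt_q; rewrite shift -(ru q.+1).
Qed.

(* The companion block sits on the first letter of each cycle. *)
Definition weight x : 'M[R]_T :=
  if val (tagged x) == 0%N then C (tag x) else 1%:M.

Fixpoint wt x u : 'M[R]_T :=
  if u is c :: u' then weight x *m wt (next x) u' else 1%:M.

(** The extra index [None] keeps the dimension positive even if there are no positions; its row in
    every [step] is zero. *)
Notation index := (option (position * 'I_T)).
Notation N := #|{: index}|.

Definition row_block x : 'M[R]_(T, N) :=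
  \matrix_(s, p) (enum_val p == Some (x, s) :> index)%:R.

Notation E := row_block.

Lemma row_block_mul_tr x y : E x *m (E y)^T = if x == y then 1%:M else 0.
Proof.
apply/matrixP => s t; rewrite !mxE.
rewrite (bigD1 (enum_rank (Some (x, s) : index))) //= !mxE enum_rankK eqxx.
rewrite mul1r.
rewrite big1 ?addr0 => [|p]; last first.
  rewrite !mxE => np; case: eqP => [e|_]; last by rewrite mul0r.
  by case/eqP: np; rewrite -e enum_valK.
case: (eqVneq x y) => [->|nxy].
  by rewrite mxE; congr (nat_of_bool _)%:R; apply/eqP/eqP => [[->]|->].
by rewrite mxE; case: eqP => // -[e _]; rewrite e eqxx in nxy.
Qed.

(** This is F_c; on row vectors it carries block [x] to block [next x]. *)
Definition step c : 'M[R]_N :=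
  \sum_(x | c == label x) (E x)^T *m weight x *m E (next x).

Lemma row_block_step x c :
  E x *m step c = if c == label x then weight x *m E (next x) else 0.
Proof.
rewrite /step mulmx_sumr.
have bl y : E x *m ((E y)^T *m weight y *m E (next y)) =
    if y == x then weight x *m E (next x) else 0.
  rewrite !mulmxA row_block_mul_tr eq_sym; case: eqP => [->|_].
    by rewrite mul1mx.
  by rewrite !mul0mx.
rewrite (eq_bigr _ (fun y _ => bl y)) -big_mkcondr /=.
case: ifP => cx; last first.
  by rewrite big1 // => y /andP[/eqP + /eqP e]; rewrite e => /eqP; rewrite cx.
rewrite (big_pred1 x) // => y; rewrite /= andbC; case: eqP => // ->.
by rewrite cx.
Qed.

(** The walk is deterministic: from [x] at most one walk spells [u], so the row block has at most
    one nonzero block. *)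
Lemma row_block_wprod x u :
  E x *m wprod step u =
  if reads x u then wt x u *m E (iter (size u) next x) else 0.
Proof.
elim: u x => [|c u IH] x /=; first by rewrite mulmx1 mul1mx.
rewrite mulmxA row_block_step; case: ifP => _; last by rewrite mul0mx.
rewrite -mulmxA IH -iterS iterSr; case: ifP => _; last by rewrite mulmx0.
by rewrite mulmxA.
Qed.

Lemma step_row_blocks c : step c = \sum_x (E x)^T *m (E x *m step c).
Proof.
rewrite [LHS]/step big_mkcond; apply: eq_bigr => x _ /=.
by rewrite row_block_step; case: ifP => _; rewrite ?mulmx0 // mulmxA.
Qed.

(** The word must be nonempty because the identity matrix, unlike a step, has a nonzero row at
    [None]. *)
Lemma wprod_row_blocks u : u != [::] ->
  wprod step u = \sum_x (E x)^T *m (E x *m wprod step u).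
Proof.
case: u => // c u _; rewrite /= [in LHS]step_row_blocks mulmx_suml.
by apply: eq_bigr => x _; rewrite !mulmxA.
Qed.

(** A nonzero term needs two positions with the same successor; these coincide as [next] is
    injective, and a position has a single label. *)
Lemma step_mul_tr c d : c != d -> step c *m (step d)^T = 0.
Proof.
move=> cd; rewrite /step mulmx_suml big1 // => x /eqP cx.
rewrite linear_sum mulmx_sumr big1 // => y /eqP dy /=.
rewrite !trmx_mul !mulmxA -(mulmxA _ (E _)) row_block_mul_tr (inj_eq next_inj).
case: eqP => [xy|_]; last by rewrite mulmx0 !mul0mx.
by rewrite cx dy xy eqxx in cd.
Qed.

Lemma tr_mul_step c d : c != d -> (step c)^T *m step d = 0.
Proof.
move=> cd; rewrite /step [X in X *m _]linear_sum mulmx_suml.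
rewrite big1 // => x /eqP cx.
rewrite mulmx_sumr big1 // => y /eqP dy /=.
rewrite !trmx_mul trmxK !mulmxA -(mulmxA _ (E _)) row_block_mul_tr.
case: eqP => [xy|_]; last by rewrite mulmx0 !mul0mx.
by rewrite cx dy xy eqxx in cd.
Qed.

Lemma row_block_trmulE n x (B : 'M[R]_(T, n)) p q :
  ((E x)^T *m B) p q =
  if enum_val p is Some (y, s) then if y == x then B s q else 0 else 0.
Proof.
rewrite mxE; case ep: (enum_val p) => [[y s]|]; last first.
  by rewrite big1 // => s _; rewrite !mxE ep mul0r.
rewrite (bigD1 s) //= big1 ?addr0 => [|t nts].
  rewrite !mxE ep; case: (eqVneq y x) => [->|yx]; first by rewrite eqxx mul1r.
  by case: eqP => [[/eqP]|_]; rewrite ?(negPf yx) // mul0r.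
rewrite !mxE ep; case: eqP => [[_ /esym/eqP]|_]; last by rewrite mul0r.
by rewrite (negPf nts).
Qed.

Lemma mul_row_block_neq0 n (B : 'M[R]_(n, T)) x s q :
  (B *m E x) s q != 0 -> exists t, enum_val q = Some (x, t).
Proof.
rewrite mxE => nz; have [t] : exists t, enum_val q == Some (x, t) :> index.
  apply/existsP; apply: contraNT nz => /existsPn none.
  by rewrite big1 // => t _; rewrite !mxE (negPf (none t)) mulr0.
by move/eqP; exists t.
Qed.

(* The cycles in P read no infinite power of w, so following w strictly
   decreases the number of powers of w that can still be read. *)
Lemma addX_det_wprod (P : pred J) w :
    (forall x, P (tag x) -> ~~ reads x (flatten (nseq (size (a (tag x))) w))) ->
  addX_det (\sum_(x | P (tag x)) (E x)^T *m (E x *m wprod step w)) = 'X^N.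
Proof.
move=> noread.
pose h x := (\sum_(M < size (a (tag x))) reads x (flatten (nseq M.+1 w)))%N.
pose ht (p : 'I_N) := if enum_val p is Some (x, _) then h x else 0%N.
apply: (addX_det_acyclic (ht := ht)) => p q; rewrite summxE.
case ep: (enum_val p) => [[x s]|]; last first.
  by rewrite big1 ?eqxx // => x _; rewrite row_block_trmulE ep.
rewrite big_mkcond (bigD1 x) //= big1 ?addr0 => [|y yx]; last first.
  by rewrite row_block_trmulE ep eq_sym (negPf yx); case: ifP.
case: ifP => [Px|]; last by rewrite eqxx.
rewrite row_block_trmulE ep eqxx row_block_wprod.
case: ifP => [rx|]; last by rewrite mxE eqxx.
case/mul_row_block_neq0=> t eq; rewrite /ht ep eq /h.
have tag_end : tag (iter (size w) next x) = tag x.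
  by case: (x) => j k; rewrite iter_next.
have := noread (iter (size w) next x); rewrite /= tag_end => /(_ Px).
have : (0 < size (a (tag x)))%N by case: (x) => j [k /=]; apply: leq_ltn_trans.
case: (size _) => // r _ /= /negPf noread_end.
(* The top term at the endpoint vanishes, its other terms are those at [x] shifted by one power, and
   the lowest term at [x] is 1. *)
rewrite big_ord_recr /= noread_end addn0 [ltnRHS]big_ord_recl.
rewrite /= cats0 rx add1n ltnS leq_eqVlt; apply/orP; left; apply/eqP.
by apply: eq_bigr => M _; rewrite [in RHS]reads_cat rx.
Qed.

Lemma wt_first j (x0 : 'I_(size (a j))) : val x0 = 0%N ->
  wt (Tagged (fun j => 'I_(size (a j))) x0) (a j) = C j.
Proof.
move=> x00; have wt1 u (k : 'I_(size (a j))) :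
    (0 < k)%N -> (k + size u <= size (a j))%N ->
    wt (Tagged (fun j => 'I_(size (a j))) k) u = 1%:M.
  elim: u k => //= c u IH k k0 le_k; rewrite /weight /= (gtn_eqF k0) mul1mx.
  case: u IH le_k => // d u IH le_k.
  have lt_k : (k.+1 < size (a j))%N.
    by apply: leq_trans le_k; rewrite /= !addnS !ltnS leq_addr.
  apply: IH; rewrite /= modn_small //.
  by rewrite addSn -addnS.
(* Only the length of the word enters [wt]; a free [v] can be destructed although [a j] occurs in
   the type of [x0]. *)
suff gen v : size v = size (a j) ->
    wt (Tagged (fun j => 'I_(size (a j))) x0) v = C j.
  exact: gen.
case: v => [|c u] szu.
  by exfalso; have := leq_ltn_trans (leq0n _) (ltn_ord x0); rewrite -szu.
rewrite /= /weight /= x00 eqxx; case: u szu => [|d u] szu.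
  by rewrite /= mulmx1.
have sz1 : (1 < size (a j))%N by rewrite -szu.
by rewrite wt1 ?mulmx1 //= x00 modn_small // -szu.
Qed.

End CyclicCover.

(** * The representation and its sigma values *)

Section Representation.

Variables (Q : quiver) (i : vertex Q -> vertex Q).
Hypotheses (iK : involutive i) (i_nofix : forall v, i v != v).
Variables (R : comNzRingType) (T : nat) (J : finType).
Variables (a : J -> seq (arrow (double_quiver i))) (C : J -> 'M[R]_T).
Hypothesis a_prim : forall j, primitive (a j).
Hypothesis a_sim : forall j l, path_sim (a j) (a l) -> j = l.

Notation arrowD := (arrow (double_quiver i)).
Notation E := (row_block R T).
Notation F := (step a C : arrowD -> _).
Notation N := #|{: option (position a * 'I_T)}|.

(** With equal dimensions at all vertices, the casts in [pathmx] disappear. *)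
Definition const_dim n : dimvec i := @DimVec Q i (fun=> n) (fun=> erefl).

Lemma wprod_pathmx n
    (X : forall x : arrow Q,
       'M[R]_(const_dim n (Defs.head x), const_dim n (tail x)))
    (b : arrowD) s :
  pathmx X b s = wprod (arrowmx X : arrowD -> 'M[R]_n) (b :: s).
Proof.
elim: s b => [|c s IH] b /=; first by rewrite mulmx1.
by congr (_ *m _); rewrite [LHS]conform_mx_id IH.
Qed.

Lemma sigma_path_const n
    (X : forall x : arrow Q,
       'M[R]_(const_dim n (Defs.head x), const_dim n (tail x)))
    t (w : seq arrowD) : w != [::] ->
  sigma_path X t w = cut_sigma t (wprod (arrowmx X : arrowD -> 'M[R]_n) w).
Proof.
case: w => // b s _; rewrite -wprod_pathmx.
by rewrite -[LHS]/(cut_sigma t (closedmx X b s)) /closedmx conform_mx_id.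
Qed.

(** The power of [w] has a length divisible by both periods, so agreement over it extends to the
    infinite periodic words. *)
Lemma reads_cyc (x : position a) (w : seq arrowD) : primitive w ->
  reads x (flatten (nseq (size (a (tag x))) w)) -> cyc_eq w (a (tag x)).
Proof.
move=> pw rd; have cw : closed_path w by case/andP: pw.
have [c _] : exists c : arrowD, c \in w.
  by case: (w) cw => // c u _; exists c; rewrite mem_head.
have w0 : (0 < size w)%N by case: (w) cw.
have a0 : (0 < size (a (tag x)))%N.
  by case: (x) => j [k /=]; apply: leq_ltn_trans.
apply: (cnth_shift_cyc (c := c) (k := tagged x)) => //; first exact: ltnW.
move=> q; set M := (size (a (tag x)) * size w)%N.
have lt_qM : (q %% M < M)%N by rewrite ltn_mod muln_gt0 a0.
have := (readsP c _ _).1 rd; rewrite size_flatten_nseq => /(_ _ lt_qM).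
rewrite nth_flatten_nseq // /cnth modn_dvdm ?dvdn_mull // => ->.
by rewrite -modnDml modn_dvdm ?dvdn_mulr // modnDml.
Qed.

Definition cover_rep (x : arrow Q) : 'M[R]_N := F (inl x) + (F (inr x))^T.

Lemma arrowmx_cover_rep (b : arrowD) :
  arrowmx (m := const_dim N) cover_rep b = F b + (F (arrowT b))^T.
Proof.
case: b => x //=; rewrite castmx_id /cover_rep linearD /= trmxK addrC.
by [].
Qed.

Lemma wprod_cover_rep (w : seq arrowD) : closed_path w ->
  wprod (fun b => F b + (F (arrowT b))^T) w = wprod F w + (wprod F (pathT w))^T.
Proof.
case: w => // b s /andP[_]; rewrite /= rcons_path => /andP[ps _].
rewrite -wprod_tr [pathT _]/(rev _) revK wprod_map.
apply: (wprodD (e := @composable (double_quiver i))) ps => c d;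
  move/(composable_arrowT iK i_nofix).
  move=> dc; rewrite step_mul_tr // -[c]arrowTK (can_eq (@arrowTK _ i)).
  by rewrite eq_sym.
by move=> dc; rewrite tr_mul_step // eq_sym.
Qed.

Lemma wprod_mul_transposed (w : seq arrowD) : closed_path w ->
  wprod F w *m (wprod F (pathT w))^T = 0.
Proof.
case: w => // b s /andP[_]; rewrite /= rcons_path => /andP[_ sb].
rewrite -wprod_tr [pathT _]/(rev _) revK wprod_map.
(* The last letter of [w] is split off to face the first transposed factor; closedness makes it
   composable with [b], so this product vanishes. *)
have -> : F b *m wprod F s = wprod F (belast b s) *m F (last b s).
  by rewrite -[LHS]/(wprod F (b :: s)) lastI -cats1 wprod_cat /= mulmx1.
rewrite /= mulmxA -(mulmxA (wprod _ _)).
rewrite step_mul_tr ?mulmx0 ?mul0mx //.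
move/(composable_arrowT iK i_nofix): sb.
by rewrite -{2}(arrowTK (last b s)) (can_eq (@arrowTK _ i)) eq_sym.
Qed.

(** A cycle reading the powers of the transpose of [a j] would be cycle [j] itself, making [a j] a
    rotation of its own transpose. *)
Lemma addX_det_transposed j : addX_det (wprod F (pathT (a j))) = 'X^N.
Proof.
have pT := primitive_pathT iK (a_prim j).
have cw : closed_path (a j) by case/andP: (a_prim j).
rewrite -(@addX_det_wprod _ _ _ _ a C xpredT (pathT (a j))).
  congr addX_det; rewrite [LHS]wprod_row_blocks //.
  by case/andP: pT => /andP[].
move=> x _; apply/negP => /(reads_cyc pT) e.
have e' : cyc_eq (a j) (pathT (a (tag x))) by rewrite -cyc_eqT pathTK.
have jx : j = tag x by apply: a_sim; rewrite /path_sim e' orbT.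
by move: e'; rewrite -jx (negPf (cyc_eq_pathTN iK i_nofix cw)).
Qed.

(** Reading [a (tag x)] from an offset makes this offset a period, so primitivity forces offset
    0. *)
Lemma row_block_cycle (x : position a) :
  E x *m wprod F (a (tag x)) =
  if val (tagged x) == 0%N then C (tag x) *m E x else 0.
Proof.
have [c _] : exists c : arrowD, c \in a (tag x).
  case/andP: (a_prim (tag x)) => /andP[]; case: (a _) => // c u _ _.
  by exists c; rewrite mem_head.
rewrite row_block_wprod; case: x => j k /=.
have -> : reads (Tagged _ k) (a j) = (val k == 0%N).
  apply/idP/eqP => [/(readsP c) rd | k0]; last first.
    apply/(readsP c) => q lt_q.
    by rewrite /= (k0 : k = 0%N :> nat) addn0 /cnth modn_small.
  have : (size (a j) %| k)%N.
    apply: (primitive_period (c := c) (a_prim j)) => q.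
    rewrite /cnth -modnDml -/(cnth c (a j) _) -rd //.
    by rewrite ltn_mod; apply: leq_ltn_trans (ltn_ord k).
  case: (val k =P 0%N) => // /eqP; rewrite -lt0n => k0.
  by move/(dvdn_leq k0); rewrite leqNgt ltn_ord.
case: eqP => // k0; rewrite wt_first // iter_next; congr (_ *m E (Tagged _ _)).
by apply: val_inj; rewrite val_iter_ordS modnDl modn_small.
Qed.

Lemma cut_sigma_cycle j t : cut_sigma t (wprod F (a j)) = cut_sigma t (C j).
Proof.
have aj0 : (0 < size (a j))%N.
  by case/andP: (a_prim j) => /andP[]; rewrite -size_eq0 lt0n.
pose x0 : position a := Tagged (fun j => 'I_(size (a j))) (Ordinal aj0).
pose G := (E x0)^T *m C j *m E x0.
(* Among the rows of cycle [j] only those of its first position survive; the other cycles form an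
   acyclic remainder. *)
have wE : wprod F (a j) = G +
    \sum_(x | predC1 j (tag x)) (E x)^T *m (E x *m wprod F (a j)).
  rewrite [LHS]wprod_row_blocks -?size_eq0 -?lt0n //.
  rewrite (bigID (fun x => predC1 j (tag x))) addrC /=; congr (_ + _).
  rewrite (bigD1 x0) /= ?eqxx // big1 ?addr0 => [|[l k] /=]; last first.
    case/andP=> /negPn/eqP lj; move: k; rewrite lj => k nk.
    have := row_block_cycle (Tagged (fun j => 'I_(size (a j))) k).
    rewrite /= => ->; rewrite ifF ?mulmx0 //=.
    by apply: contraNF nk => /eqP k0; apply/eqP; congr Tagged; apply: val_inj.
  by have := row_block_cycle x0; rewrite /= => ->; rewrite mulmxA.
have cG : cut_sigma t G = cut_sigma t (C j).
  rewrite /G -mulmxA cut_sigmaC -mulmxA row_block_mul_tr eqxx mulmx1.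
  by [].
rewrite wE -cG; apply/cut_sigma_addX_det/addX_det_add.
  rewrite mulmx_sumr big1 // => x jx; rewrite /G !mulmxA -(mulmxA _ (E x0)).
  rewrite row_block_mul_tr; case: eqP => [e|_].
    by move: jx; rewrite -e /= eqxx.
  by rewrite mulmx0 !mul0mx.
apply: addX_det_wprod => x jx; apply/negP => /(reads_cyc (a_prim j)) e.
by case/eqP: jx; apply/esym/a_sim; rewrite /path_sim e.
Qed.

Lemma exists_rep_sigma : exists m : dimvec i, (forall v, (0 < m v)%N) /\
  exists X : forall x : arrow Q, 'M[R]_(m (Defs.head x), m (tail x)),
    forall j t, sigma_path X t (a j) = cut_sigma t (C j).
Proof.
exists (const_dim N); split; first by move=> v /=; rewrite card_option.
exists cover_rep => j t; have cw : closed_path (a j) by case/andP: (a_prim j).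
rewrite sigma_path_const; last by case/andP: cw.
rewrite (eq_wprod _ arrowmx_cover_rep) wprod_cover_rep // -cut_sigma_cycle.
apply/cut_sigma_addX_det/addX_det_add; first exact: wprod_mul_transposed.
by rewrite addX_det_tr addX_det_transposed.
Qed.

End Representation.

(** * Evaluation of polynomials and the conclusion *)

Lemma eq_peval_supp (F : fieldType) (I : choiceType) (S : comAlgType F)
    (v w : I -> S) (p : polyring F I) :
    (forall k x, k \in msupp p -> x \in finsupp k -> v x = w x) ->
  peval v p = peval w p.
Proof.
move=> vw; rewrite /peval !mmapE; apply: eq_big_seq => k kp; congr (_ * _).
by apply: eq_big_seq => x /(vw k x kp) ->.
Qed.

(** A product of powers of variables is a single basis monomial, whose exponents [expU] and [prodU]
    track. *)
Lemma peval_pvar (F : fieldType) (I : choiceType) (p : polyring F I) :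
  peval (@pvar F I) p = p.
Proof.
have mulU (k l : {cmonom I}) :
    << k >> * << l >> = << mmul k l >> :> polyring F I.
  by rewrite malgM_def fgmulUU mulr1.
have expU (x : I) q : exists2 k : {cmonom I}, pvar F x ^+ q = << k >> &
    forall y, k y = if x == y then q else 0%N.
  elim: q => [|q [k e kE]].
    by exists mone => [|y]; rewrite ?expr0 // cm1; case: eqP.
  exists (mmul (ucm x) k).
    by rewrite exprS e; apply: mulU.
  by move=> y; rewrite cmM cmU kE; case: eqP.
rewrite [RHS]monalgE /peval mmapE; apply: eq_bigr => k _.
suff -> : meval (@pvar F I) k = << k >> :> polyring F I.
  have kE (z : F) : z%:A * << k >> = << z *g k >> :> polyring F I.
    have -> : z%:A = z%:MP :> polyring F I by rewrite -mul_malgC mulr1.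
    by rewrite malgM_def fgmulUU mulr1 mul1m.
  exact: kE.
have prodU (r : seq I) : exists2 l : {cmonom I},
    \prod_(x <- r) pvar F x ^+ k x = << l >> &
    forall y, l y = (\sum_(x <- r) (x == y) * k x)%N.
  elim: r => [|x r [l e lE]].
    by exists mone => [|y]; rewrite big_nil ?cm1.
  have [l' e' lE'] := expU x (k x); exists (mmul l' l).
    by rewrite big_cons e e'; apply: mulU.
  by move=> y; rewrite big_cons cmM lE lE'; case: eqP; rewrite ?mul1n.
have [l e lE] := prodU (finsupp k); rewrite /meval e; congr << _ >>.
apply/eqP/cmP => y; rewrite lE; have [yk|yk] := boolP (y \in finsupp k).
  rewrite (bigD1_seq y) ?fset_uniq //= eqxx mul1n big1 ?addn0 // => x.
  by move/negPf ->.
rewrite big_seq big1 => [|x xk]; first by apply/esym/eqP; rewrite cmE_eq0.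
by case: eqP => // xy; rewrite -xy xk in yk.
Qed.

Theorem lemma6p1 (F : fieldType) (F_infinite : infinite_set [set: F])
    (Q : quiver) (i : vertex Q -> vertex Q) (n : dimvec i)
    (iK : involutive i) (i_nofix : forall v, i v != v) :
  free_relations F i = [set 0].
Proof.
apply/seteqP; split=> [f f_rel | _ -> m _]; last exact: rmorph0.
pose gens : seq (Ngen i) :=
  flatten [seq enum_fset (finsupp k) | k : {cmonom _} <- enum_fset (msupp f)].
pose classes : seq (Nclass i) := undup [seq x.1 | x <- gens].
(* Blocks of size [T.+1] accommodate every index t that occurs in [f]. *)
pose T := \max_(x <- gens) val x.2.
pose c (j : 'I_(size classes)) : Nclass i := tnth (in_tuple classes) j.
pose a j := val (generic_quotient.repr (c j)).
have a_prim j : primitive (a j) by apply: valP.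
have c_inj : injective c.
  by apply/tuple_uniqP; apply: undup_uniq.
have a_sim j l : path_sim (a j) (a l) -> j = l.
  move=> jl; apply: c_inj; rewrite -(reprK (c j)) -(reprK (c l)).
  by apply/eqmodP.
have exC j : exists C : 'M[Nsigma F i]_T.+1,
    forall t : {t : nat | (0 < t)%N}, (val t <= T)%N ->
    cut_sigma (val t) C = pvar F (c j, t).
  (* The default 0 arises only at [t = 0], outside the range of [exists_sigma_mx]. *)
  have [C CE] := @exists_sigma_mx (Nsigma F i) T (fun t =>
    if insub t is Some u then pvar F (c j, u) else 0).
  exists C => -[t t0] /= tT; rewrite CE ?t0 ?leqW // insubT.
  by congr (pvar F (_, _)); apply: val_inj.
have [C CE] := fin_all_exists exC.
have [m [m_pos [X XE]]] := exists_rep_sigma iK i_nofix C a_prim a_sim.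
pose ev : Defs.coord m -> Nsigma F i :=
  fun x => X (tag x) (tagged x).1 (tagged x).2.
have evC (z : F) : peval ev z%:A = z%:A :> Nsigma F i.
  have -> : z%:A = z%:MP :> coord_ring F m by rewrite -mul_malgC mulr1.
  exact: pevalC.
have := congr1 (peval ev) (f_rel m m_pos).
rewrite rmorph0 /Upsilon (rmorph_peval (f := peval ev) _ _ evC) => f0.
(* Both sides become evaluations of [f], at the variables and at the sigma values of [X]; they need
   only agree on the generators in [gens]. *)
rewrite /= -[LHS]peval_pvar -[RHS]f0; apply: eq_peval_supp => k x kf xk.
have x_gen : x \in gens by apply/flatten_mapP; exists k.
have x_cl : x.1 \in classes by rewrite mem_undup map_f.
have [j cj] : exists j, c j = x.1.
  by have /tnthP[j ->] : x.1 \in in_tuple classes by []; exists j.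
rewrite sigma_path_map -cj.
rewrite (eq_sigma_path (Y := X)) => [|b].
  rewrite XE CE ?cj -?surjective_pairing //.
  by rewrite (leq_bigmax_seq x).
apply/matrixP => p q; rewrite !mxE.
exact: peval_var.
Qed.
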